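(* Let $I$ be a finite set of $N$ agents and $O=\{o_1,\dots,o_M\}$ a finite set of $M$ objects with capacities $q_1,\dots,q_M$ (positive integers) such that $\sum_{m=1}^M q_m\ge N$. Let $\psi$ be a rank-minimizing mechanism with full support, i.e. a mechanism such that for every preference profile $\succ_I$ and every allocation $\alpha\in\mathcal A$, $\psi(\succ_I)(\alpha)>0$ if and only if $\alpha\in\bar{\mathcal A}(\succ_I)$. Then $\psi$ is not obviously manipulable.
   Context: Preferences: each agent $i\in I$ has a strict preference relation (type) $\succ_i$, a strict linear ranking of $O$; $\mathcal P_i$ is the set of all strict rankings of $O$, and $\mathcal P^I=\prod_{i\in I}\mathcal P_i$ is the set of preference profiles $\succ_I=(\succ_i,\succ_{-i})$. Write $o\succsim_i o'$ if $o\succ_i o'$ or $o=o'$. The rank of $o$ for an agent with preference $\succ_i$ is $r_i(o)=|\{o'\in O: o'\succsim_i o\}|$ (favorite object has rank 1). Allocations: an allocation is a function $\alpha:I\to O$, $i\mapsto\alpha_i$, with $|\{i\in I:\alpha_i=o_m\}|\le q_m$ for every $m$. $\mathcal A$ is the set of all allocations. A random allocation is a probability distribution $\mu$ on $\mathcal A$; $\mathcal M$ is the set of these; $\mathrm{supp}(\mu)=\{\alpha\in\mathcal A:\mu(\alpha)>0\}$. Rank minimization: at a profile $\succ_I$, the average rank of $\alpha$ is $\bar r(\alpha)=\frac1N\sum_{i\in I}r_i(\alpha_i)$ (ranks computed with $\succ_I$), and $\bar{\mathcal A}(\succ_I)=\{\alpha\in\mathcal A:\bar r(\alpha)\le\bar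 r(\alpha')\ \forall\alpha'\in\mathcal A\}$. Mechanisms: a mechanism is a function $\psi:\mathcal P^I\to\mathcal M$; $\psi(\succ_I)(\alpha)$ is the probability it places on $\alpha$. It is rank-minimizing if $\mathrm{supp}(\psi(\succ_I))\subseteq\bar{\mathcal A}(\succ_I)$ for all $\succ_I$, and has full support if moreover $\psi(\succ_I)(\alpha)>0$ for all $\alpha\in\bar{\mathcal A}(\succ_I)$ and all $\succ_I$. Non-obvious manipulability: for an agent $i$ with true type $\succ_i$ and a random allocation $\mu$, let $\bar\rho_i(\mu)=\max_{\alpha\in\mathrm{supp}(\mu)}r_i(\alpha_i)$ and $\underline\rho_i(\mu)=\min_{\alpha\in\mathrm{supp}(\mu)}r_i(\alpha_i)$, where $r_i$ is always computed with the true type $\succ_i$. A mechanism $\psi$ is not obviously manipulable (NOM) if for every agent $i$, every type $\succ_i$ and every $\succ_i'\ne\succ_i$: (i) $\max_{\succ_{-i}}\bar\rho_i(\psi(\succ_i,\succ_{-i}))\le\max_{\succ_{-i}}\bar\rho_i(\psi(\succ_i',\succ_{-i}))$, and (ii) $\min_{\succ_{-i}}\underline\rho_i(\psi(\succ_i,\succ_{-i}))\le\min_{\succ_{-i}}\underline\rho_i(\psi(\succ_i',\succ_{-i}))$. Otherwise $\psi$ is obviously manipulable. *)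

(* Defs.v *)
From HB Require Import structures.
From mathcomp Require Import all_boot all_order all_algebra.

Set Implicit Arguments.
Unset Strict Implicit.
Unset Printing Implicit Defensive.

Import Order.TTheory GRing.Theory Num.Theory.
Local Open Scope ring_scope.

Section Preferences.
Variable O : finType.

Definition strict_linear (s : {set O * O}) : bool :=
  [&& [forall x, (x, x) \notin s],
      [forall x, forall y, forall z,
         ((x, y) \in s) && ((y, z) \in s) ==> ((x, z) \in s)]
    & [forall x, forall y, (x != y) ==> ((x, y) \in s) || ((y, x) \in s)]].

(* A strict ranking is stored as its graph, so that the rankings form a finType
   with extensional equality. *)
Record pref := Pref {
  pref_graph : {set O * O};
  pref_graphP : strict_linear pref_graph
}.
HB.instance Definition _ := [isSub for pref_graph].
HB.instance Definition _ := [Finite of pref by <:].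

Definition prefers (t : pref) (o o' : O) : bool := (o, o') \in pref_graph t.

Definition weakly_prefers (t : pref) (o o' : O) : bool :=
  prefers t o o' || (o == o').

Definition rank (t : pref) (o : O) : nat := #|[set o' | weakly_prefers t o' o]|.

End Preferences.

Section Allocations.
Variables (I O : finType) (q : O -> nat).

Definition within_capacity (a : {ffun I -> O}) : bool :=
  [forall o, #|[set i | a i == o]| <= q o]%N.

Record alloc := Alloc {
  alloc_fun :> {ffun I -> O};
  allocP : within_capacity alloc_fun
}.
HB.instance Definition _ := [isSub for alloc_fun].
HB.instance Definition _ := [Finite of alloc by <:].

Definition profile := {ffun I -> pref O}.

Definition avg_rank (P : profile) (a : alloc) : rat :=
  (\sum_(i : I) rank (P i) (a i))%N%:R / #|I|%:R.

Definition rank_min_allocs (P : profile) : {set alloc} :=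
  [set a | [forall a' : alloc, avg_rank P a <= avg_rank P a']].

Definition other_profile (i : I) := {ffun {j : I | j != i} -> pref O}.

Definition join_profile (i : I) (t : pref O) (s : other_profile i) : profile :=
  [ffun j => if insub j is Some k then s k else t].

End Allocations.

Section Mechanisms.
Variables (R : realFieldType) (I O : finType) (q : O -> nat).

Record rand_alloc := RandAlloc {
  prob :> alloc I q -> R;
  prob_ge0 : forall a, 0 <= prob a;
  prob_sum1 : \sum_a prob a = 1
}.

Definition supp (mu : rand_alloc) : {set alloc I q} := [set a | 0 < mu a].

Definition mechanism := profile I O -> rand_alloc.

Definition rank_minimizing (psi : mechanism) : Prop :=
  forall P, supp (psi P) \subset rank_min_allocs q P.

Definition full_support (psi : mechanism) : Prop :=
  forall P a, a \in rank_min_allocs q P -> 0 < psi P a.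

(* Supports and sets of opponents' profiles are nonempty and ranks lie between
   1 and #|O|, so the default values 0 (for maxima) and #|O| (for minima) below
   never alter the extremum. *)

Definition worst_rank (i : I) (t : pref O) (mu : rand_alloc) : nat :=
  (\max_(a in supp mu) rank t (a i))%N.

Definition best_rank (i : I) (t : pref O) (mu : rand_alloc) : nat :=
  \big[minn/#|O|]_(a in supp mu) rank t (a i).

(* In the next two definitions t is the true type and t' the reported one. *)
Definition worst_case (psi : mechanism) (i : I) (t t' : pref O) : nat :=
  (\max_(s : other_profile O i)
     worst_rank i t (psi (join_profile t' s)))%N.

Definition best_case (psi : mechanism) (i : I) (t t' : pref O) : nat :=
  \big[minn/#|O|]_(s : other_profile O i)
    best_rank i t (psi (join_profile t' s)).

Definition not_obviously_manipulable (psi : mechanism) : Prop :=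
  forall (i : I) (t t' : pref O), t' != t ->
    (worst_case psi i t t <= worst_case psi i t t')%N /\
    (best_case psi i t t <= best_case psi i t t')%N.

End Mechanisms.

(* Main.v *)
Require Import Defs.
From mathcomp Require Import all_boot all_order all_algebra.
From mathcomp Require Import perm.

(* Worst case: if truth-telling can give agent i an object of true rank k, then
   the set B of objects that i ranks above k has total capacity less than N.
   Hence, when i reports t' and everybody else has type t' too, some agent is
   assigned an object outside B at a rank-minimizing allocation. Exchanging that
   agent with i does not change the average rank, so by full support i may get
   an object of true rank at least k.
   Best case: at an allocation giving i its favorite object, let every other
   agent rank its own assignment first; this allocation is then rank-minimizing. *)

Set Implicit Arguments.
Unset Strict Implicit.
Unset Printing Implicit Defensive.

Import Order.TTheory GRing.Theory Num.Theory.

Section Raise.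
Variables (O : finType) (t : pref O) (o : O).

Definition raise_graph : {set O * O} :=
  [set p | (p.2 != o) && ((p.1 == o) || prefers t p.1 p.2)].

Lemma raise_graphP : strict_linear raise_graph.
Proof.
case/and3P: (pref_graphP t) => /forallP tI /forallP tT /forallP tC.
apply/and3P; split.
- by apply/forallP=> x; rewrite inE /= /prefers (negPf (tI x)) orbF andNb.
- apply/forallP=> x; apply/forallP=> y; apply/forallP=> z; apply/implyP.
  rewrite !inE /= => /andP[/andP[yo xy] /andP[zo yz]]; rewrite zo /=.
  case/orP: xy => [->//|xy]; rewrite (negPf yo) /= in yz.
  rewrite /prefers in xy yz *; move/forallP: (tT x) => /(_ y)/forallP/(_ z).
  by rewrite xy yz => /= ->; rewrite orbT.
- apply/forallP=> x; apply/forallP=> y; apply/implyP=> xy; rewrite !inE /=.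
  case: (eqVneq y o) => [yo|yo] /=; first by rewrite -yo xy.
  case: (eqVneq x o) => //= xo.
  by move/forallP: (tC x) => /(_ y)/implyP; apply.
Qed.

Definition raise : pref O := Pref raise_graphP.

(** Under [raise], only [o] is weakly preferred to [o], and [o] is weakly preferred to
    everything. *)
Lemma rank_raise_le x : rank raise o <= rank raise x.
Proof.
apply/subset_leq_card/subsetP=> y.
rewrite !inE /weakly_prefers /prefers !inE /= eqxx /= => /eqP->.
by rewrite eqxx /= andbT eq_sym orNb.
Qed.

End Raise.

Section Allocations.
Variables (I O : finType) (q : O -> nat).
Implicit Types (a : alloc I q) (P : profile I O).

Lemma rank_min_allocsP P a :
  reflect (forall a', \sum_i rank (P i) (a i) <= \sum_i rank (P i) (a' i))
          (a \in rank_min_allocs q P).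
Proof.
rewrite inE; case: (posnP #|I|) => [I0|I0].
  (* With no agents the average divides by zero and equals 0, so every allocation is minimizing; the
     rank sums are empty as well. *)
  have avg0 a' : avg_rank P a' = 0%R by rewrite /avg_rank I0 invr0 mulr0.
  apply: (iffP forallP) => [_ a'|_ a']; last by rewrite !avg0.
  by rewrite big_pred0 // => j; have := card0_eq I0 j; rewrite !inE.
have le a' : (avg_rank P a <= avg_rank P a')%R =
    (\sum_i rank (P i) (a i) <= \sum_i rank (P i) (a' i)).
  by rewrite ler_pM2r ?ler_nat // invr_gt0 ltr0n.
by apply: (iffP forallP) => h a'; have := h a'; rewrite le.
Qed.

Lemma exists_rank_min P a : exists a', a' \in rank_min_allocs q P.
Proof.
case: (@arg_minnP _ a xpredT (fun b : alloc I q => \sum_i rank (P i) (b i)) isT).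
by move=> b _ bP; exists b; apply/rank_min_allocsP=> a'; apply: bP.
Qed.

Lemma exists_alloc (i : I) (o : O) :
  0 < q o -> #|I| <= \sum_o q o -> exists a, a i = o.
Proof.
(* [S] is the set of seats, [q o] of them for each object [o]. Agents are seated injectively, then a
   transposition of seats puts [i] on a seat of [o]. *)
move=> qo qI; pose S : finType := {o : O & 'I_(q o)}.
have IS : #|I| <= #|S|.
  rewrite card_tagged sumnE big_map big_enum /=.
  by rewrite (eq_bigr q) // => x _; rewrite card_ord.
pose f x : S := enum_val (widen_ord IS (enum_rank x)).
have f_inj : injective f.
  move=> x y /enum_val_inj/(congr1 val)/= xy.
  by apply/enum_rank_inj/val_inj.
pose u : S := Tagged (fun o => 'I_(q o)) (Ordinal qo).
pose g x := tperm (f i) u (f x).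
have g_inj : injective g by move=> x y /perm_inj/f_inj.
have cap : within_capacity q [ffun x => tag (g x)].
  apply/forallP=> z; rewrite -(card_imset _ g_inj) -[leqRHS]card_ord.
  apply: leq_trans (leq_imset_card (fun k : 'I_(q z) => existT _ z k : S) predT).
  apply/subset_leq_card/subsetP=> y /imsetP[x]; rewrite inE ffunE => /eqP + ->.
  by case: (g x) => w k /= wz; subst w; apply: imset_f.
by exists (Alloc cap); rewrite ffunE /g tpermL.
Qed.

Lemma reassign_cap a (i : I) (o : O) :
  #|[set j | (j != i) && (a j == o)]| < q o ->
  within_capacity q [ffun j => if j == i then o else a j].
Proof.
move=> lt_q; apply/forallP=> z; have [->|zo] := eqVneq z o.
  apply: leq_trans lt_q; rewrite (cardsD1 i) !inE ffunE !eqxx add1n ltnS.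
  apply/subset_leq_card/subsetP=> j; rewrite !inE ffunE.
  by case: (j == i).
apply: leq_trans (forallP (allocP a) z).
apply/subset_leq_card/subsetP=> j; rewrite !inE ffunE.
by case: (j == i) => //; rewrite eq_sym (negPf zo).
Qed.

Lemma swap_cap a (i j : I) : within_capacity q [ffun k => a (tperm i j k)].
Proof.
apply/forallP=> z; apply: leq_trans (forallP (allocP a) z).
rewrite -(card_imset _ (@perm_inj _ (tperm i j))).
apply/subset_leq_card/subsetP=> y /imsetP[k]; rewrite !inE ffunE => kz ->.
exact: kz.
Qed.

(* Any object that i strictly prefers to a i is filled by the other agents,
   since otherwise moving i to it would lower the average rank. *)
Lemma rank_min_better_cap P a (i : I) :
  a \in rank_min_allocs q P ->
  \sum_(o | rank (P i) o < rank (P i) (a i)) q o < #|I|.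
Proof.
move=> /rank_min_allocsP a_min.
rewrite -cardsT (cardsD1 i) inE add1n ltnS.
(* The middle sum counts the agents other than [i] by their object; leaving [i] out gives the strict
   inequality. *)
apply: (@leq_trans (\sum_o #|[set j | (j != i) && (a j == o)]|)).
  rewrite [leqRHS](bigID (fun o => rank (P i) o < rank (P i) (a i))) /=.
  apply: leq_trans (leq_addr _ _); apply: leq_sum => o lt_o.
  rewrite leqNgt; apply/negP=> /reassign_cap cap.
  have := a_min (Alloc cap); rewrite leqNgt => /negP; apply.
  rewrite (bigD1 i) //= [ltnRHS](bigD1 i) //= ffunE eqxx -addSn leq_add //.
  by apply: leq_sum => j /negPf ji; rewrite ffunE ji.
rewrite -[leqRHS]sum1_card (partition_big a xpredT) //=; apply: leq_sum => o _.
rewrite sum1dep_card; apply/subset_leq_card/subsetP=> j.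
by rewrite !inE andbT.
Qed.

(** Pigeonhole: were every agent assigned inside [B], the capacity of [B] would be at least the
    number of agents. *)
Lemma exists_assigned_outside a (B : pred O) :
  \sum_(o | B o) q o < #|I| -> exists j, ~~ B (a j).
Proof.
move=> ltI; apply/existsP; rewrite -negb_forall; apply: contraL ltI => /forallP aB.
rewrite -leqNgt -sum1_card (partition_big a B) //=.
by apply: leq_sum => o _; rewrite sum1dep_card; apply: (forallP (allocP a) o).
Qed.

Lemma join_profile_self (i : I) (t : pref O) (s : other_profile O i) :
  join_profile t s i = t.
Proof. by rewrite ffunE insubF ?eqxx. Qed.

Lemma join_profile_restrict (i j : I) (t : pref O) (f : I -> pref O) :
  j != i -> join_profile t [ffun k : {j | j != i} => f (val k)] j = f j.
Proof. by move=> ji; rewrite ffunE insubT /= ffunE. Qed.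

End Allocations.

Lemma bigminn_inf (T : finType) (x : nat) (A : pred T) (F : T -> nat) (i : T) :
  A i -> \big[minn/x]_(j | A j) F j <= F i.
Proof. by move=> Ai; rewrite -minEnat; exact: (@bigmin_le_cond _ nat). Qed.

(** The default [x] takes part in the minimum, so it has to be bounded as well. *)
Lemma bigminn_ge (T : finType) (x m : nat) (A : pred T) (F : T -> nat) :
  m <= x -> (forall i, A i -> m <= F i) -> m <= \big[minn/x]_(j | A j) F j.
Proof.
by move=> mx mF; elim/big_ind: _ => // y z my mz; rewrite leq_min my.
Qed.

Theorem theorem1 (R : realFieldType) (I O : finType) (q : O -> nat)
    (q_pos : forall o : O, (0 < q o)%N)
    (q_sum : (#|I| <= \sum_(o : O) q o)%N)
    (psi : mechanism R I q) :
  rank_minimizing psi -> full_support psi -> not_obviously_manipulable psi.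
Proof.
move=> psi_min psi_full i t t' _; split.
- apply/bigmax_leqP=> s _; apply/bigmax_leqP=> a /(subsetP (psi_min _)) a_min.
  have := rank_min_better_cap i a_min; rewrite join_profile_self => capB.
  pose s' : other_profile O i := [ffun _ => t'].
  have P' j : join_profile t' s' j = t'.
    by rewrite ffunE; case: insubP => // k _ _; rewrite ffunE.
  have [b /rank_min_allocsP b_min] := exists_rank_min (join_profile t' s') a.
  have [j] := exists_assigned_outside b capB; rewrite -leqNgt => le_j.
  (* If [j] is [i], the swap is trivial and [c] agrees with [b]. *)
  pose c := Alloc (swap_cap b i j).
  have c_supp : c \in supp (psi (join_profile t' s')).
    rewrite inE psi_full //; apply/rank_min_allocsP=> a'.
    apply: leq_trans (b_min a').
    (* All reported types equal [t'], so permuting the agents preserves the rank sum. *)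
    rewrite [leqRHS](reindex_inj (@perm_inj _ (tperm i j))) /=.
    by apply: leq_sum => k _; rewrite !P' ffunE.
  apply: leq_trans le_j _.
  rewrite -[b j](_ : c i = _); last by rewrite ffunE tpermL.
  apply: leq_trans (leq_bigmax s').
  exact: (leq_bigmax_cond (F := fun a : alloc I q => rank t (a i)) _ c_supp).
(* Without objects the total capacity would be 0, yet there is the agent [i]. *)
have [o0 _] : exists o0 : O, true.
  apply/existsP; rewrite -[X in is_true X]negbK negb_exists; apply/negP=> /forallP no.
  move: q_sum; rewrite big_pred0 => [|o]; last by have := no o.
  by rewrite leqn0 => /eqP/card0_eq/(_ i).
case: (@arg_minnP _ o0 xpredT (rank t) isT) => o _ o_min.
have [a ai] := exists_alloc i (q_pos o) q_sum.
pose s : other_profile O i := [ffun k => raise t (a (val k))].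
have a_supp : a \in supp (psi (join_profile t s)).
  (* At [a] every agent holds the top object of its reported type, so the rank sum is minimal term
     by term. *)
  rewrite inE psi_full //; apply/rank_min_allocsP=> a'; apply: leq_sum => j _.
  have [->|ji] := eqVneq j i; first by rewrite join_profile_self ai o_min.
  by rewrite (join_profile_restrict t (fun j => raise t (a j)) ji) rank_raise_le.
apply: (@leq_trans (rank t o)).
  apply: leq_trans (bigminn_inf _ _ (isT : xpredT s)) _; rewrite -ai.
  exact: (bigminn_inf _ (fun a : alloc I q => rank t (a i)) a_supp).
(* No report can beat the true favorite [o], and its rank is at most the default [#|O|]. *)
apply: bigminn_ge => [|s' _]; first exact: max_card.
by apply: bigminn_ge => [|b _]; [exact: max_card|exact: o_min].
Qed.
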